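(* Let $K$ be any field, and let $n$ be a positive integer. Then the following statements hold. (1) The simple Lie commutator $[x_1,x_2,\ldots,x_{n+1}]$ in $K\langle X\rangle$ is ideally concise. (2) The outer Lie commutator $[g_n,x_{2^n+1}]$ in $K\langle X\rangle$ is ideally concise, where $g_n=g_n(x_1,\ldots,x_{2^n})$ is the $n$-th derived series commutator. In particular, the Lie centre-by-metabelian polynomial $[[[x_1,x_2],[x_3,x_4]],x_5]$ is ideally concise.
   Context: ''Algebra'' means a not necessarily unital associative algebra over the fixed field $K$. $K\langle X\rangle$ is the free associative $K$-algebra on $X=\{x_1,x_2,\ldots\}$. $[a,b]=ab-ba$, and longer commutators are left-justified: $[a_1,\ldots,a_k]=[[a_1,\ldots,a_{k-1}],a_k]$. The derived series commutators are defined recursively by $g_1=[x_1,x_2]$ and, for $n\ge2$, $g_n=[g_{n-1}(x_1,\ldots,x_{2^{n-1}}),g_{n-1}(x_{2^{n-1}+1},\ldots,x_{2^n})]$. For an algebra $A$ and $f=f(x_1,\ldots,x_k)\in K\langle X\rangle$, let $\mathcal S_A(f)$ and $\mathcal I_A(f)$ be, respectively, the $K$-subspace and the two-sided ideal of $A$ generated by the set of $f$-values $\{f(a_1,\ldots,a_k): a_1,\ldots,a_k\in A\}$. The polynomial $f$ is ideally concise if, for every $K$-algebra $A$, $\mathcal I_A(f)$ is finite-dimensional whenever $\mathcal S_A(f)$ is finite-dimensional. *)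

(* Defs.v *)
From HB Require Import structures.
From mathcomp Require Import all_boot all_algebra finmap.
From mathcomp Require Import monalg.
From mathcomp Require Import boolp classical_sets.

Set Implicit Arguments.
Unset Strict Implicit.
Unset Printing Implicit Defensive.

Import GRing.Theory.
Local Open Scope classical_set_scope.
Local Open Scope ring_scope.

HB.mixin Record Lmodule_isNuAlgebra (K : fieldType) A of GRing.Lmodule K A := {
  numul : A -> A -> A;
  numulA : associative numul;
  numulDl : left_distributive numul +%R;
  numulDr : right_distributive numul +%R;
  scalenuAl : forall (k : K) (a b : A), k *: numul a b = numul (k *: a) b;
  scalenuAr : forall (k : K) (a b : A), k *: numul a b = numul a (k *: b)
}.

(* Associative K-algebras that need not have a unit element. *)
#[short(type="nuAlgType")]
HB.structure Definition NuAlgebra (K : fieldType) :=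
  { A of GRing.Lmodule K A & Lmodule_isNuAlgebra K A }.

Section NuAlgebraTheory.
Variables (K : fieldType) (A : nuAlgType K).
Implicit Types a b c : A.

Lemma numul0r a : numul 0 a = 0.
Proof. by apply: (addrI (numul 0 a)); rewrite -numulDl !addr0. Qed.

Lemma numulr0 a : numul a 0 = 0.
Proof. by apply: (addrI (numul a 0)); rewrite -numulDr !addr0. Qed.

Lemma numul_suml I (r : seq I) (P : pred I) (F : I -> A) b :
  numul (\sum_(i <- r | P i) F i) b = \sum_(i <- r | P i) numul (F i) b.
Proof.
by apply: (big_morph (numul^~ b)) => [x y|]; rewrite ?numulDl ?numul0r.
Qed.

Lemma numul_sumr I (r : seq I) (P : pred I) (F : I -> A) b :
  numul b (\sum_(i <- r | P i) F i) = \sum_(i <- r | P i) numul b (F i).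
Proof.
by apply: (big_morph (numul b)) => [x y|]; rewrite ?numulDr ?numulr0.
Qed.

Definition lie a b : A := numul a b - numul b a.

(* lieln a [:: b1; ...; bk] is the left-justified [a, b1, ..., bk]. *)
Definition lieln a (s : seq A) : A := foldl lie a s.

Definition subspace (V : set A) : Prop :=
  [/\ V 0, (forall u v, V u -> V v -> V (u + v))
    & forall (k : K) v, V v -> V (k *: v)].

Definition ideal (V : set A) : Prop :=
  subspace V /\ forall a v, V v -> V (numul a v) /\ V (numul v a).

Definition span (S : set A) : set A := smallest subspace S.

Definition ideal_gen (S : set A) : set A := smallest ideal S.

Definition findim (V : set A) : Prop :=
  exists s : seq A, V = span [set` s].

(* The empty word only gets a value for totality: it never occurs in an
   element of the free algebra below. *)
Definition wordval (x : nat -> A) (w : seq nat) : A :=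
  if w is i :: w' then foldl (fun a j => numul a (x j)) (x i) w' else 0.

Lemma wordval_cat x v w : v != [::] -> w != [::] ->
  wordval x (v ++ w) = numul (wordval x v) (wordval x w).
Proof.
case: v w => [|i v] // [|j w] // _ _ /=.
rewrite foldl_cat /=; move: (foldl _ _ v) => a.
elim/last_ind: w => [|w k IHw] //=.
by rewrite -!cats1 !foldl_cat /= IHw numulA.
Qed.

End NuAlgebraTheory.

(* {malg K[{fmonom nat}]} is the free unital algebra. Since algebras need not
   be unital, K<X> is its subalgebra of polynomials without constant term,
   which are those that can be evaluated in an arbitrary algebra. *)
Section FreeAlgebra.
Variable K : fieldType.

Definition noconst_pred : {pred {malg K[{fmonom nat}]}} :=
  fun f => f@_(@mone {fmonom nat}) == 0.
Arguments noconst_pred _ /.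
Definition noconst := [qualify a f | noconst_pred f].

Fact noconst_submod : submod_closed noconst.
Proof.
split=> [|k f g]; rewrite !qualifE /= ?mcoeff0 // => /eqP f0 /eqP g0.
by rewrite mcoeffD mcoeffZ f0 g0 mulr0 addr0.
Qed.

HB.instance Definition _ :=
  GRing.isSubmodClosed.Build K {malg K[{fmonom nat}]} noconst_pred
    noconst_submod.

Record freeAlg := FreeAlg
  { freeval :> {malg K[{fmonom nat}]}; freevalP : freeval \is a noconst }.

HB.instance Definition _ := [isSub for freeval].
HB.instance Definition _ := [Choice of freeAlg by <:].
HB.instance Definition _ := [SubChoice_isSubLmodule of freeAlg by <:].

Implicit Types f g : freeAlg.

Fact freemul_subproof f g : freeval f * freeval g \is a noconst.
Proof.
by rewrite qualifE /= rmorphM /= (eqP (freevalP f)) mul0r.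
Qed.

Definition freemul f g : freeAlg := FreeAlg (freemul_subproof f g).

Fact freemulA : associative freemul.
Proof. by move=> f g h; apply/val_inj; rewrite /= mulrA. Qed.

Fact freemulDl : left_distributive freemul +%R.
Proof. by move=> f g h; apply/val_inj; rewrite /= mulrDl. Qed.

Fact freemulDr : right_distributive freemul +%R.
Proof. by move=> f g h; apply/val_inj; rewrite /= mulrDr. Qed.

Fact scalefreeAl (k : K) f g : k *: freemul f g = freemul (k *: f) g.
Proof. by apply/val_inj; rewrite /= scalerAl. Qed.

Fact scalefreeAr (k : K) f g : k *: freemul f g = freemul f (k *: g).
Proof.
apply/val_inj; rewrite /=; apply/malgP => m.
rewrite mcoeffZ !(@malgMEw _ _ (msupp f) (msupp g)) ?msuppZ_le //.
rewrite !raddf_sum mulr_sumr; apply: eq_bigr => i _ /=.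
rewrite !raddf_sum mulr_sumr; apply: eq_bigr => j _ /=.
by rewrite !mcoeffU mcoeffZ mulrnAr [in RHS]mulrCA.
Qed.

HB.instance Definition _ := Lmodule_isNuAlgebra.Build K freeAlg
  freemulA freemulDl freemulDr scalefreeAl scalefreeAr.

Fact freevar_subproof i : << fmu i >> \is a @noconst.
Proof. by rewrite qualifE /= mcoeffU1 fmP fmU fm1. Qed.

Definition freevar (i : nat) : freeAlg := FreeAlg (freevar_subproof i).

End FreeAlgebra.

(* Variables are numbered from 0: 'x_i is the (i+1)-st element of X. *)
Notation "''x_' i" := (freevar _ i) (at level 8, i at level 2, format "''x_' i").

Section Evaluation.
Variables (K : fieldType) (A : nuAlgType K).
Implicit Types (x : nat -> A) (f g : freeAlg K).

Definition feval x f : A := \sum_(w <- msupp f) f@_w *: wordval x w.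

Lemma fevalEw (d : {fset {fmonom nat}}) x f : (msupp f `<=` d)%fset ->
  feval x f = \sum_(w <- d) f@_w *: wordval x w.
Proof.
move=> le; rewrite [LHS](big_fset_incl _ le) => //= w _ /mcoeff_outdom ->.
by rewrite scale0r.
Qed.

Lemma feval_var x i : feval x 'x_i = x i.
Proof.
by rewrite /feval /= msuppU1 big_seq_fset1 mcoeffU1 eqxx scale1r fmU.
Qed.

Lemma feval_is_linear x : linear (feval x).
Proof.
move=> k f g; pose d := (msupp f `|` msupp g)%fset.
rewrite !(@fevalEw d) ?fsubsetUl ?fsubsetUr //=; last first.
  apply: (fsubset_trans (msuppD_le _ _)); apply: fsetSU; exact: msuppZ_le.
rewrite scaler_sumr -big_split /=; apply: eq_bigr => w _.
by rewrite mcoeffD mcoeffZ scalerDl scalerA.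
Qed.

HB.instance Definition _ x :=
  GRing.isLinear.Build K (freeAlg K) A *:%R (feval x) (feval_is_linear x).

Lemma fevalM x f g : feval x (numul f g) = numul (feval x f) (feval x g).
Proof.
pose ev (h : {malg K[{fmonom nat}]}) : A :=
  \sum_(w <- msupp h) h@_w *: wordval x w.
have evEw (d : {fset {fmonom nat}}) h : (msupp h `<=` d)%fset ->
    ev h = \sum_(w <- d) h@_w *: wordval x w.
  move=> le; rewrite [LHS](big_fset_incl _ le) => //= w _ /mcoeff_outdom ->.
  by rewrite scale0r.
have ev0 : ev 0 = 0 by rewrite /ev msupp0 big_seq_fset0.
have evD h1 h2 : ev (h1 + h2) = ev h1 + ev h2.
  rewrite !(@evEw (msupp h1 `|` msupp h2)%fset) ?fsubsetUl ?fsubsetUr //.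
    by rewrite -big_split; apply: eq_bigr => w _; rewrite mcoeffD scalerDl.
  exact: msuppD_le.
have evU c w : ev << c *g w >> = c *: wordval x w.
  by rewrite (evEw _ _ msuppU_le) big_seq_fset1 mcoeffUU.
have nz h w : w \in msupp (freeval h) -> (w : seq nat) != [::].
  apply: contraL => /eqP w0; rewrite -mcoeff_eq0.
  have -> : w = mone by apply/eqP; rewrite fmP fm1 w0.
  exact: freevalP.
rewrite -[LHS]/(ev (freeval f * freeval g)) malgME (big_morph ev evD ev0).
rewrite numul_suml big_seq [RHS]big_seq; apply: eq_bigr => v vf.
rewrite (big_morph ev evD ev0) numul_sumr big_seq [RHS]big_seq.
apply: eq_bigr => w wg; rewrite evU fmM wordval_cat.
- by rewrite -scalenuAl -scalenuAr scalerA.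
- exact: nz vf.
- exact: nz wg.
Qed.

Lemma feval_lie x f g : feval x (lie f g) = lie (feval x f) (feval x g).
Proof. by rewrite /lie linearB /= !fevalM. Qed.

(* Only the x i for the finitely many variables 'x_i of f matter, so these are
   the values of f at finite tuples of elements of A. *)
Definition fvalues f : set A := [set feval x f | x in [set: nat -> A]].

End Evaluation.

Section LieCommutators.
Variable K : fieldType.

(* The seed 'x_0 is only there to obtain g_1 = [x_1, x_2], see dcomm1. *)
Fixpoint dcomm (n : nat) : freeAlg K :=
  if n is m.+1 then
    lie (dcomm m) (feval (fun i => 'x_(2 ^ m + i)) (dcomm m))
  else 'x_0.

Lemma dcomm1 : dcomm 1 = lie 'x_0 'x_1.
Proof. by rewrite /= feval_var. Qed.

Lemma dcomm2 : dcomm 2 = lie (lie 'x_0 'x_1) (lie 'x_2 'x_3).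
Proof.
by rewrite -[LHS]/(lie (dcomm 1) (feval _ (dcomm 1))) dcomm1 feval_lie !feval_var.
Qed.

End LieCommutators.

Definition ideally_concise (K : fieldType) (f : freeAlg K) : Prop :=
  forall A : nuAlgType K,
    findim (span (@fvalues K A f)) -> findim (ideal_gen (@fvalues K A f)).

(* Main.v *)
From HB Require Import structures.
From mathcomp Require Import all_boot all_algebra.
From mathcomp Require Import monalg boolp classical_sets.
Require Import Defs.

(** Let [S] be the set of all [[v, a]] with [v] in a given set [V] and [a] in
    [A], and let [W] be its span. Since [a [v, b] = [v, a b] - [v, a] b], the
    ideal generated by [S] is [W + W A]. If [W] is finite-dimensional, then it
    is spanned by finitely many elements [[v, a]] of [S]. For each of them the
    image of [ad v] lies in [W], so the centralizer of [v] has finite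
    codimension; for [c] in this centralizer [[v, a] c = [v, a c]] is again in
    [W], hence [[v, a] A] is finite-dimensional, and so is [W A]. *)

Set Implicit Arguments.
Unset Strict Implicit.
Unset Printing Implicit Defensive.

Import GRing.Theory.
Local Open Scope classical_set_scope.
Local Open Scope ring_scope.

(** * Linear algebra: spans, finite dimension, and maps of finite rank *)

Section Span.
Variables (K : fieldType) (A : nuAlgType K).
Implicit Types (S T : set A) (s t : seq A).

Lemma span_subspace S : subspace (span S).
Proof.
split=> [|u v Su Sv|k v Sv] T TP; have [[T0 TD TZ] _] := TP.
- exact: T0.
- by apply: TD; [exact: (Su T) | exact: (Sv T)].
- by apply: TZ; exact: (Sv T).
Qed.

Lemma ideal_gen_ideal S : ideal (ideal_gen S).
Proof.
split; first split=> [|u v Su Sv|k v Sv] T TP; try have [[[T0 TD TZ] _] _] := TP.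
- exact: T0.
- by apply: TD; [exact: (Su T) | exact: (Sv T)].
- by apply: TZ; exact: (Sv T).
by move=> a v Sv; split=> T TP; have [[_ Tm] _] := TP; have [] := Tm a v (Sv T TP).
Qed.

Lemma sub_span S : S `<=` span S.
Proof. exact: sub_gen_smallest. Qed.

Lemma span_sub S T : subspace T -> S `<=` T -> span S `<=` T.
Proof. by move=> Ts ST; apply: smallest_sub. Qed.

Lemma spanS S T : S `<=` T -> span S `<=` span T.
Proof.
move=> ST; apply: span_sub (span_subspace T) _.
exact: subset_trans ST (@sub_span T).
Qed.

Lemma span_mem s x : x \in s -> span [set` s] x.
Proof. by move=> xs; apply: sub_span. Qed.

Lemma span_catl s t : span [set` s] `<=` span [set` s ++ t].
Proof. by apply: spanS => x /= xs; rewrite mem_cat xs. Qed.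

Lemma span_catr s t : span [set` t] `<=` span [set` s ++ t].
Proof. by apply: spanS => x /= xs; rewrite mem_cat xs orbT. Qed.

Lemma subspaceB T u v : subspace T -> T u -> T v -> T (u - v).
Proof. by move=> [_ TD TZ] Tu Tv; rewrite -scaleN1r; apply: TD => //; apply: TZ. Qed.

Lemma span_consP x s y :
  span [set` x :: s] y -> exists k : K, span [set` s] (y - k *: x).
Proof.
have [s0 sD sZ] := span_subspace [set` s].
move: y; apply: span_sub => [|z].
  split=> [|u v [k uk] [l vl]|l v [k vk]].
  - by exists 0; rewrite scale0r subr0.
  - by exists (k + l); rewrite scalerDl opprD addrACA; apply: sD.
  - by exists (l * k); rewrite -scalerA -scalerBr; apply: sZ.
rewrite /= inE => /orP[/eqP->|zs].
  by exists 1; rewrite scale1r subrr.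
by exists 0; rewrite scale0r subr0; apply: span_mem.
Qed.

(** Gaussian elimination by induction on [s]: some [u] in [T] outside the span of the tail serves as
    pivot for the head [x], and the rest of [T] reduces to its intersection with that span. *)
Lemma findim_sub T s : subspace T -> T `<=` span [set` s] -> findim T.
Proof.
elim: s T => [|x s IHs] T Ts Tsub.
  exists [::]; apply/seteqP; split=> //.
  by apply: span_sub.
have [Tsub'|/existsNP[u /not_implyP[Tu su]]] := pselect (T `<=` span [set` s]).
  exact: IHs.
have [s0 sD sZ] := span_subspace [set` s]; have [T0 TD TZ] := Ts.
have [|t tE] := IHs (T `&` span [set` s]) _ (@subIsetr _ _ _).
  split=> [|v w [? ?] [? ?]|k v [? ?]]; split=> //.
  - exact: TD.
  - exact: sD.
  - exact: TZ.
  - exact: sZ.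
have tT v : span [set` t] v -> T v by rewrite -tE => -[].
exists (u :: t); apply/seteqP; split=> [y Ty|]; last first.
  apply: span_sub => // y /=; rewrite inE => /orP[/eqP->//|yt].
  by apply: tT; apply: span_mem.
have [k uk] := span_consP (Tsub _ Tu); have [l yl] := span_consP (Tsub _ Ty).
have k0 : k != 0.
  by apply/negP => /eqP k0; apply: su; rewrite k0 scale0r subr0 in uk.
have [t0 tD tZ] := span_subspace [set` u :: t].
(* Modulo the span of [s], [y] is [l *: x] and [u] is [k *: x], so subtracting [(l / k) *: u] from
   [y] eliminates [x]. *)
rewrite -(subrK ((l / k) *: u) y); apply: tD; last first.
  by apply: tZ; apply: span_mem; exact: mem_head.
apply: (@span_catr [:: u] t); rewrite -tE; split.
  by apply: subspaceB => //; apply: TZ.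
have -> : y - (l / k) *: u = (y - l *: x) - (l / k) *: (u - k *: x).
  by rewrite scalerBr scalerA divfK // opprB addrA subrK.
by apply: (subspaceB (span_subspace _)) => //; apply: sZ.
Qed.

Lemma span_finite S y :
  span S y -> exists2 t : seq A, [set` t] `<=` S & span [set` t] y.
Proof.
move: y; apply: span_sub => [|z Sz]; last first.
  exists [:: z]; first by move=> w /=; rewrite inE => /eqP->.
  by apply: span_mem; rewrite inE.
split=> [|u v [t tS tu] [r rS rv]|k v [t tS tv]].
- by exists [::] => //; have [] := span_subspace [set` [::]].
- exists (t ++ r) => [w /=|].
    by rewrite mem_cat => /orP[/tS|/rS].
  have [_ + _] := span_subspace [set` t ++ r].
  by apply; [apply: span_catl | apply: span_catr].
- by exists t => //; have [_ _] := span_subspace [set` t]; apply.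
Qed.

(** Each of the finitely many vectors spanning [span T] is a combination of finitely many elements
    of [T]; collecting these gives [t]. That [t] lies inside [T] is what later makes the spanning
    vectors genuine commutators. *)
Lemma finite_spanning_subset T s : T `<=` span [set` s] ->
  exists2 t : seq A, [set` t] `<=` T & T `<=` span [set` t].
Proof.
move=> Ts.
have [r rE] : findim (span T).
  apply: (@findim_sub _ s); first exact: span_subspace.
  by apply: span_sub Ts; exact: span_subspace.
have {}rT : {in r, forall y, span T y} by move=> y yr; rewrite rE; apply: span_mem.
suff [t tT rt] : exists2 t : seq A, [set` t] `<=` T & [set` r] `<=` span [set` t].
  exists t => //; apply: subset_trans (@sub_span T) _; rewrite rE.
  by apply: span_sub rt; exact: span_subspace.
elim: r rT {rE} => [|y r IHr] rT; first by exists [::].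
have [t1 t1T t1y] := span_finite (rT y (mem_head y r)).
have [z zr|t2 t2T rt2] := IHr; first by apply: rT; rewrite inE zr orbT.
exists (t1 ++ t2) => z /=.
  by rewrite mem_cat => /orP[/t1T|/t2T].
rewrite inE => /orP[/eqP->|/rt2]; first exact: span_catl.
exact: span_catr.
Qed.

(** A map of finite rank has a kernel of finite codimension: preimages of vectors spanning the range
    span a supplement of the kernel, up to overlap. *)
Lemma ker_finite_codim (h : {linear A -> A}) s :
  (forall a, span [set` s] (h a)) ->
  exists t, forall a, exists2 b, span [set` t] b & h (a - b) = 0.
Proof.
move=> hs; have [|r rh hr] := @finite_spanning_subset (range h) s.
  by move=> _ [a _ <-]; apply: hs.
have [t rE] : exists t, r = map h t.
  elim: r rh {hr} => [|y r IHr] rh; first by exists [::].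
  have [a _ <-] := rh y (mem_head y r).
  have [z zr|t ->] := IHr; first by apply: rh; rewrite /= inE zr orbT.
  by exists (a :: t).
have [t0 tD tZ] := span_subspace [set` t].
have lift : span [set` r] `<=` h @` span [set` t].
  apply: span_sub => [|z /=].
    split=> [|_ _ [u tu <-] [v tv <-]|k _ [v tv <-]].
    - by exists 0 => //; rewrite raddf0.
    - by exists (u + v); [apply: tD|rewrite raddfD].
    - by exists (k *: v); [apply: tZ|rewrite linearZ].
  by rewrite rE => /mapP[a at_ ->]; exists a => //; apply: span_mem.
exists t => a; have [|b tb hb] := lift (h a); first by apply: hr; exists a.
by exists b => //; rewrite raddfB /= hb subrr.
Qed.

End Span.

(** * The ideal generated by the commutators [[v, a]] with [v] in [V] *)

Section CommutatorIdeal.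
Variables (K : fieldType) (A : nuAlgType K).
Implicit Types (a b c v : A) (s t : seq A).

Lemma numulNr a b : numul a (- b) = - numul a b.
Proof. by rewrite -!scaleN1r scalenuAr. Qed.

Lemma numulNl a b : numul (- a) b = - numul a b.
Proof. by rewrite -!scaleN1r scalenuAl. Qed.

Lemma lie_is_linear v : linear (lie v).
Proof.
move=> k a b; rewrite /lie numulDr numulDl -scalenuAr -scalenuAl.
by rewrite scalerBr opprD addrACA.
Qed.

HB.instance Definition _ v := GRing.isLinear.Build K A A *:%R (lie v) (lie_is_linear v).

Lemma lie_numul v a b : lie v (numul a b) = numul (lie v a) b + numul a (lie v b).
Proof.
by rewrite /lie numulDl numulDr numulNl numulNr !numulA addrA subrK.
Qed.

(** With [span_sub], this reduces a claim about products to the case where the left factor is a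
    spanning vector; the next lemma does so for the right factor. *)
Lemma subspace_numull (T : set A) b :
  subspace T -> subspace [set a | T (numul a b)].
Proof.
move=> [T0 TD TZ]; split=> [|u v /= Tu Tv|k v /= Tv]; rewrite /=.
- by rewrite numul0r.
- by rewrite numulDl; apply: TD.
- by rewrite -scalenuAl; apply: TZ.
Qed.

Lemma subspace_numulr (T : set A) b :
  subspace T -> subspace [set a | T (numul b a)].
Proof.
move=> [T0 TD TZ]; split=> [|u v /= Tu Tv|k v /= Tv]; rewrite /=.
- by rewrite numulr0.
- by rewrite numulDr; apply: TD.
- by rewrite -scalenuAr; apply: TZ.
Qed.

Lemma lie_mulr_findim v a s : (forall b, span [set` s] (lie v b)) ->
  exists t, forall b, span [set` t] (numul (lie v a) b).
Proof.
move=> vs; have [r rP] := @ker_finite_codim _ _ (lie v) s vs.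
(* Write [b = (b - c) + c] with [b - c] centralizing [v] and [c] in the span of [r]: [s] covers
   [[v, a] (b - c) = [v, a (b - c)]], and the mapped list covers [[v, a] c]. *)
exists (s ++ map (numul (lie v a)) r) => b.
set t := s ++ _; have [c rc vbc] := rP b.
have [_ tD _] := span_subspace [set` t].
rewrite -(subrK c b) numulDr; apply: tD.
  apply: span_catl; have := vs (numul a (b - c)).
  by rewrite lie_numul vbc numulr0 addr0.
apply: (span_sub (subspace_numulr (lie v a) (span_subspace [set` t])) _ rc) => d dr.
by apply: span_catr; apply: span_mem; apply: map_f.
Qed.

Variable V : set A.

Definition lie_set : set A := [set lie v a | v in V & a in [set: A]].

Lemma ideal_gen_lie_set :
  ideal_gen lie_set `<=`
  span (lie_set `|` [set numul w b | w in lie_set & b in [set: A]]).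
Proof.
set J := span _; have Js : subspace J by exact: span_subspace.
have JS v a : V v -> J (lie v a).
  by move=> Vv; apply: sub_span; left; exists v => //; exists a.
have JSA v a b : V v -> J (numul (lie v a) b).
  by move=> Vv; apply: sub_span; right; exists (lie v a); [exists v => //; exists a|exists b].
apply: smallest_sub; last by move=> _ [v Vv [a _ <-]]; apply: JS.
split=> // b w Jw; split; move: w Jw.
  apply: (span_sub (subspace_numulr b Js)) => w /= [[v Vv [a _ <-]]|].
    have -> : numul b (lie v a) = lie v (numul b a) - numul (lie v b) a.
      by rewrite lie_numul addrC addKr.
    by apply: (subspaceB Js); [apply: JS|apply: JSA].
  move=> [_ [v Vv [a _ <-]] [c _ <-]].
  (* The Leibniz identity above, multiplied by [c] on the right. *)
  have -> : numul b (numul (lie v a) c) =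
      numul (lie v (numul b a)) c - numul (lie v b) (numul a c).
    by rewrite lie_numul [in RHS]numulDl -!numulA addrC addKr.
  by apply: (subspaceB Js); apply: JSA.
apply: (span_sub (subspace_numull b Js)) => w /= [[v Vv [a _ <-]]|]; first exact: JSA.
by move=> [_ [v Vv [a _ <-]] [c _ <-]]; rewrite /= -numulA; apply: JSA.
Qed.

Lemma findim_ideal_gen_lie_set :
  findim (span lie_set) -> findim (ideal_gen lie_set).
Proof.
move=> [s0 s0E]; have [|s sS Ss] := @finite_spanning_subset _ _ lie_set s0.
  by rewrite -s0E; apply: sub_span.
have [t tP] : exists t, forall w b, w \in s -> span [set` t] (numul w b).
  (* The induction runs over a copy of [s], while [Ss] keeps the full list, whose span must contain
     the whole image of [lie v] at every stage. *)
  elim: {1 2}s sS => [|w r IHr] rS; first by exists [::].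
  have [v Vv [a _ vaw]] := rS w (mem_head w r).
  have [|t1 t1P] := @lie_mulr_findim v a s.
    by move=> b; apply: Ss; exists v => //; exists b.
  have [z zr|t2 t2P] := IHr; first by apply: rS; rewrite /= inE zr orbT.
  exists (t1 ++ t2) => z b; rewrite inE => /orP[/eqP->|zr].
    by apply: span_catl; rewrite -vaw.
  by apply: span_catr; apply: t2P.
apply: (@findim_sub _ _ _ (s ++ t)); first by have [] := ideal_gen_ideal lie_set.
apply: subset_trans ideal_gen_lie_set _.
apply: span_sub => [|w [/Ss|[u /Ss su [b _ <-]]]]; first exact: span_subspace.
  exact: span_catl.
apply: span_catr.
by apply: (span_sub (subspace_numull b (span_subspace [set` t])) _ su) => z zs; apply: tP.
Qed.

End CommutatorIdeal.

(** * Commutators of a polynomial with a fresh variable *)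

Section OuterCommutators.
Variable K : fieldType.
Implicit Types (g : freeAlg K) (m n : nat).

(* That [g] involves only the variables ['x_i] with [i < m] is expressed by its
   values. *)
Definition vars_below m g : Prop :=
  forall (A : nuAlgType K) (x y : nat -> A),
    (forall i, (i < m)%N -> x i = y i) -> feval x g = feval y g.

(** Since 'x_m is independent of the variables of [g], the values are exactly the [[v, a]] with [v]
    a value of [g] and [a] arbitrary. *)
Lemma ideally_concise_lie_var m g :
  vars_below m g -> ideally_concise (lie g 'x_m).
Proof.
move=> gm A.
suff -> : @fvalues K A (lie g 'x_m) = lie_set (@fvalues K A g).
  exact: findim_ideal_gen_lie_set.
apply/seteqP; split=> [_ [x _ <-]|_ [_ [x _ <-] [a _ <-]]].
  rewrite feval_lie feval_var; exists (feval x g); first by exists x.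
  by exists (x m).
(* Resetting the variable of index [m] to [a] leaves the value of [g] unchanged. *)
exists (fun i => if i == m then a else x i) => //.
rewrite feval_lie feval_var eqxx; congr lie.
by apply: gm => i im; rewrite ltn_eqF.
Qed.

Lemma feval_lieln (A : nuAlgType K) (x : nat -> A) (f : freeAlg K) s :
  feval x (lieln f s) = lieln (feval x f) (map (feval x) s).
Proof. by elim: s f => [|g s IHs] f //=; rewrite IHs feval_lie. Qed.

Lemma vars_below_lieln m :
  vars_below m.+1 (lieln 'x_0 [seq 'x_i | i <- iota 1 m]).
Proof.
move=> A x y xy; rewrite !feval_lieln !feval_var xy //; congr lieln.
rewrite -!map_comp; apply/eq_in_map => i; rewrite mem_iota add1n => /andP[_ im] /=.
by rewrite !feval_var xy.
Qed.

(** Evaluation is a homomorphism, so it commutes with substitution; this handles the shifted copy of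
    [dcomm] in the recursion. *)
Lemma feval_comp (A : nuAlgType K) (x : nat -> A) (y : nat -> freeAlg K) g :
  feval x (feval y g) = feval (fun i => feval x (y i)) g.
Proof.
rewrite [feval y g]/feval linear_sum; apply: eq_bigr => w _.
rewrite linearZ /=; congr (_ *: _).
(* The empty word has the default value 0 on both sides. *)
case: (w : seq nat) => [|i s] /=; first exact: linear0.
by elim/last_ind: s => [|s j IHs] //; rewrite -!cats1 !foldl_cat /= fevalM IHs.
Qed.

Lemma vars_below_dcomm n : vars_below (2 ^ n) (dcomm K n).
Proof.
elim: n => [|n IHn] A x y xy; first by rewrite /= !feval_var xy.
rewrite /= !feval_lie !feval_comp; congr lie; apply: IHn => i lt_i.
  by apply: xy; rewrite expnS mul2n -addnn ltn_addr.
by rewrite !feval_var xy // expnS mul2n -addnn ltn_add2l.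
Qed.

End OuterCommutators.

Theorem corollary1p10 (K : fieldType) (n : nat) (n_gt0 : (0 < n)%N) :
  ideally_concise (lieln 'x_0 [seq 'x_i | i <- iota 1 n] : freeAlg K) /\
  ideally_concise (lie (dcomm K n) 'x_(2 ^ n)) /\
  ideally_concise (lie (lie (lie 'x_0 'x_1) (lie 'x_2 'x_3)) 'x_4 : freeAlg K).
Proof.
have concise_dcomm m : ideally_concise (lie (dcomm K m) 'x_(2 ^ m)).
  by apply: ideally_concise_lie_var; apply: vars_below_dcomm.
(* The last polynomial is the case [m = 2], as [2 ^ 2] computes to 4. *)
split; last by split; [apply: concise_dcomm | rewrite -dcomm2; apply: concise_dcomm].
(* With [n = m.+1], splitting off the last index exposes the outermost bracket, with a shorter
   commutator in 'x_0 up to 'x_m on its left. *)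
case: n n_gt0 => // m _; rewrite -[m.+1]addn1 iotaD map_cat /lieln foldl_cat /= add1n.
by apply: ideally_concise_lie_var; apply: vars_below_lieln.
Qed.
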